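(* Fix $z\in\mathbb C^+$. Let $M\in\mathcal M_N^+$ solve $M=F(M)$, and let $M'\in\mathcal M_N^+$ and $R\in\mathbb C^{N\times N}$ satisfy $M'=F(M')+R$. Then there are constants $\epsilon_z>0$ and $c_z$ (depending on $z$ and $K$ but not on $N$) such that if $\|M'-M\|_\infty\vee\|R\|_\infty\le\epsilon_z$, then $\|M'-M\|_\infty\le c_z\|R\|_\infty$.
   Context: $K\ge1$ integer. For each $N$, $(x_{ij})_{1\le i\le j\le N}$ are real centered random variables with $x_{ij}$ independent of $(x_{kl})_{|i-k|\vee|j-l|>K}$ and $\operatorname{Var}(x_{ij})\le1$; $\xi_{ijkl}=\mathbb E[x_{ij}x_{kl}]$ if $i\le j,k\le l$; $\xi_{ijkl}=\xi_{jilk}$ if $i>j,k>l$; $\xi_{ijkl}=0$ otherwise. $(\Xi(M))_{ik}:=\frac1N\sum_{j,l=1}^N\xi_{ijkl}M_{jl}$, $F(M):=(-z-\Xi(M))^{-1}$. $\mathcal M_N^+=\{M\in\mathbb C^{N\times N}:\frac1{2i}(M-M^* )>0\}$. $\|A\|_\infty=\max_{i,j}|A_{ij}|$. *)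

(* Defs.v *)
From Stdlib Require Import Reals Arith ClassicalEpsilon.
Open Scope R_scope.

Record Cplx := mkC { re : R ; im : R }.
Definition C0 : Cplx := mkC 0 0.
Definition C1 : Cplx := mkC 1 0.
Definition RtoC (x : R) : Cplx := mkC x 0.
Definition Cadd (a b : Cplx) : Cplx := mkC (re a + re b) (im a + im b).
Definition Copp (a : Cplx) : Cplx := mkC (- re a) (- im a).
Definition Csub (a b : Cplx) : Cplx := Cadd a (Copp b).
Definition Cmul (a b : Cplx) : Cplx :=
  mkC (re a * re b - im a * im b) (re a * im b + im a * re b).
Definition Cconj (a : Cplx) : Cplx := mkC (re a) (- im a).
Definition Cabs (a : Cplx) : R := sqrt (re a * re a + im a * im a).

Fixpoint csum (n : nat) (f : nat -> Cplx) : Cplx :=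
  match n with O => C0 | S m => Cadd (csum m f) (f m) end.
Fixpoint rsum (n : nat) (f : nat -> R) : R :=
  match n with O => 0 | S m => rsum m f + f m end.
(* finite maximum of nonnegative quantities over 0 .. n-1 (0 if n = 0) *)
Fixpoint rmaxn (n : nat) (f : nat -> R) : R :=
  match n with O => 0 | S m => Rmax (rmaxn m f) (f m) end.

(* ---------- N x N complex matrices (0-based indices i, j < N;
   entries outside this range are irrelevant) ---------- *)
Definition Mat := nat -> nat -> Cplx.
Definition Mzero : Mat := fun _ _ => C0.
Definition Mid : Mat := fun i j => if Nat.eqb i j then C1 else C0.
Definition Madd (A B : Mat) : Mat := fun i j => Cadd (A i j) (B i j).
Definition Msub (A B : Mat) : Mat := fun i j => Csub (A i j) (B i j).
Definition Mmul (N : nat) (A B : Mat) : Mat :=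
  fun i j => csum N (fun k => Cmul (A i k) (B k j)).
Definition Madj (A : Mat) : Mat := fun i j => Cconj (A j i).
Definition Meq (N : nat) (A B : Mat) : Prop :=
  forall i j, (i < N)%nat -> (j < N)%nat -> A i j = B i j.

Definition is_inverse (N : nat) (A B : Mat) : Prop :=
  Meq N (Mmul N A B) Mid /\ Meq N (Mmul N B A) Mid.
Definition Minv (N : nat) (A : Mat) : Mat :=
  epsilon (inhabits Mzero) (fun B => is_inverse N A B).

Definition supnorm (N : nat) (A : Mat) : R :=
  rmaxn N (fun i => rmaxn N (fun j => Cabs (A i j))).

Definition ImM (M : Mat) : Mat :=
  fun i j => Cmul (mkC 0 (- / 2)) (Csub (M i j) (Madj M i j)).
Definition posdef (N : nat) (H : Mat) : Prop :=
  forall v : nat -> Cplx, (exists i, (i < N)%nat /\ v i <> C0) ->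
    0 < re (csum N (fun i => csum N (fun j =>
               Cmul (Cconj (v i)) (Cmul (H i j) (v j))))).
Definition Mplus (N : nat) (M : Mat) : Prop := posdef N (ImM M).

Definition natdist (a b : nat) : nat := ((a - b) + (b - a))%nat.

(* cov i j k l stands for E[x_ij x_kl] (i <= j, k <= l, 0-based).
   Admissible covariance arrays of families (x_ij)_{i<=j<N} of real centered
   random variables with Var <= 1 and x_ij independent of the far family
   (x_kl)_{|i-k| v |j-l| > K}: symmetric, positive semidefinite, diagonal
   <= 1 and vanishing at distance > K. *)
Definition cov_admissible (K N : nat) (cov : nat -> nat -> nat -> nat -> R) : Prop :=
  (forall i j k l, (i <= j)%nat -> (j < N)%nat -> (k <= l)%nat -> (l < N)%nat ->
      cov i j k l = cov k l i j) /\
  (forall a : nat -> nat -> R,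
      0 <= rsum N (fun i => rsum N (fun j => rsum N (fun k => rsum N (fun l =>
             if andb (Nat.leb i j) (Nat.leb k l)
             then a i j * a k l * cov i j k l else 0))))) /\
  (forall i j, (i <= j)%nat -> (j < N)%nat -> cov i j i j <= 1) /\
  (forall i j k l, (i <= j)%nat -> (j < N)%nat -> (k <= l)%nat -> (l < N)%nat ->
      (K < Nat.max (natdist i k) (natdist j l))%nat -> cov i j k l = 0).

Definition xi (cov : nat -> nat -> nat -> nat -> R) (i j k l : nat) : R :=
  if andb (Nat.leb i j) (Nat.leb k l) then cov i j k l
  else if andb (Nat.ltb j i) (Nat.ltb l k) then cov j i l k
  else 0.

Definition Xi (N : nat) (cov : nat -> nat -> nat -> nat -> R) (M : Mat) : Mat :=
  fun i k => Cmul (RtoC (/ INR N))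
    (csum N (fun j => csum N (fun l => Cmul (RtoC (xi cov i j k l)) (M j l)))).

Definition Fmap (N : nat) (cov : nat -> nat -> nat -> nat -> R) (z : Cplx) (M : Mat) : Mat :=
  Minv N (fun i k => Csub (Cmul (Copp z) (Mid i k)) (Xi N cov M i k)).

(* Main.v *)
(** Write [F' = F(M')], [D = M' - M] and [E = Xi(D)].  The resolvent identity gives
    [D = M E F' + R], hence [E = Xi(M E F') + Xi(R)].  Put
    [a(u) = -Im <u, M^-1 u>] and [b(v) = -Im <v, F'^-1 v>], so that
    [a(M^* u) = Im <u, M u>] and [b(F' v) = Im <v, F' v>], and measure [E] by the
    least [t] with [2 Re <u, E v> <= t (a(u) + b(v))] for all [u], [v].  The covariance
    being positive semidefinite, [Xi] is completely positive, so this bound on [E]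
    turns into [2 Re <u, Xi(M E F') v> <= t (Im <u, Xi(M) u> + Im <v, Xi(F') v>)].  The
    right-hand side is at most [(1 - gam) t (a(u) + b(v))]: up to a small [Xi(R)], the
    forms of [Xi(M)] and [Xi(F')] are [a] and [b] minus [Im z] times the squared norm,
    and [a], [b] are bounded because [Xi] is banded.  Hence
    [t <= (1 - gam) t + O(|R|)], that is [t = O(|R|)] uniformly in [N], and the entries
    of [M E F'] are at most [t / Im z]. *)

Require Import Defs.
From Stdlib Require Import Reals ClassicalEpsilon.
Open Scope R_scope.

(* The module confines the notations of MathComp, which would change the meaning of
   [<=] and [<] in the theorem. *)
Module DysonStability.

From mathcomp Require Import all_boot all_order all_algebra.
From mathcomp Require Import ring lra zify complex reals Rstruct.
Set Implicit Arguments.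
Unset Strict Implicit.
Unset Printing Implicit Defensive.
Import Order.TTheory GRing.Theory Num.Theory Normc.
Local Open Scope ring_scope.
Local Open Scope complex_scope.

(** * Gram factorisation of positive semidefinite arrays *)

Section Gram.
Variables (R : rcfType) (T : finType).
Implicit Types (A : T -> T -> R) (a : T -> R).

Definition qform A a : R := \sum_p \sum_q a p * a q * A p q.

(** Second-order expansion of the form along one coordinate. The coefficient [c] is chosen
    differently at each use: to read off a diagonal entry, to contradict positivity, and to complete
    the square. *)
Lemma qform_shift A a (s : T) (c : R) : (forall p q, A p q = A q p) ->
  qform A (fun p => a p + c * (p == s)%:R) =
  qform A a + 2 * c * (\sum_p a p * A s p) + c ^+ 2 * A s s.
Proof.
move=> symA.
have sum1 (g : T -> R) : \sum_p (p == s)%:R * g p = g s.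
  by rewrite (bigD1 s) //= eqxx mul1r big1 ?addr0 // => p /negPf ->; rewrite mul0r.
rewrite /qform.
have row p : \sum_q (a p + c * (p == s)%:R) * (a q + c * (q == s)%:R) * A p q =
    \sum_q a p * a q * A p q + c * a p * A p s +
    (p == s)%:R * (c * (\sum_q a q * A p q) + c ^+ 2 * A p s).
  rewrite -(sum1 (fun q => A p q)) !mulr_sumr -!big_split /= mulr_sumr.
  by rewrite -big_split /=; apply: eq_bigr => q _; ring.
rewrite (eq_bigr _ (fun p _ => row p)).
rewrite !big_split /= sum1.
rewrite (_ : \sum_i c * a i * A i s = c * \sum_p a p * A s p); last first.
  by rewrite mulr_sumr; apply: eq_bigr => p _; rewrite symA mulrA.
ring.
Qed.

Lemma psd_diag_ge0 A s : (forall p q, A p q = A q p) ->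
  (forall a, 0 <= qform A a) -> 0 <= A s s.
Proof.
move=> symA psdA; have := psdA (fun p => 0 + 1 * (p == s)%:R).
rewrite qform_shift // /qform [X in X + _ + _]big1 => [|p _]; last first.
  by rewrite big1 // => q _; rewrite !mul0r.
by rewrite big1 => [|p _]; rewrite ?mul0r // mulr0 !add0r expr1n mul1r.
Qed.

(** When [A s s = 0] the form is affine along the coordinate [s], and an affine function bounded
    below has slope zero. *)
Lemma psd_diag_eq0 A s q : (forall p q, A p q = A q p) ->
  (forall a, 0 <= qform A a) -> A s s = 0 -> A s q = 0.
Proof.
move=> symA psdA As0; apply/eqP; apply/negPn/negP => Asq.
pose a p : R := (p == q)%:R.
have lin : \sum_p a p * A s p = A s q.
  by rewrite (bigD1 q) //= /a eqxx mul1r big1 ?addr0 // => p /negPf ->; rewrite mul0r.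
(* The coefficient is chosen so that the form takes the value [-1]. *)
have := psdA (fun p => a p + (- (qform A a + 1) / (2 * A s q)) * (p == s)%:R).
rewrite qform_shift // lin As0 mulr0 addr0.
rewrite (_ : 2 * _ * _ = - (qform A a + 1)); last by field; rewrite Asq.
lra.
Qed.

(* Cholesky elimination: each step clears the row and column of one pivot. *)
Lemma psd_gram A : (forall p q, A p q = A q p) -> (forall a, 0 <= qform A a) ->
  exists L : seq (T -> R), forall p q, A p q = \sum_(f <- L) f p * f q.
Proof.
(* Induction on the size of a set [S] outside which the rows vanish; by symmetry the columns vanish
   there too. *)
suff H n : forall A (S : {set T}), (#|S| <= n)%N ->
    (forall p q, p \notin S -> A p q = 0) ->
    (forall p q, A p q = A q p) -> (forall a, 0 <= qform A a) ->
  exists L : seq (T -> R), forall p q, A p q = \sum_(f <- L) f p * f q.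
  by move=> symA psdA; apply: (H #|T| A setT) => // [|p q]; rewrite ?cardsT ?inE.
elim: n => [|n IH] {}A S cardS suppA symA psdA.
  exists [::] => p q; rewrite big_nil suppA //.
  by move: cardS; rewrite leqn0 cards_eq0 => /eqP ->; rewrite inE.
have [S0|[s sS]] := set_0Vmem S.
  by exists [::] => p q; rewrite big_nil suppA // S0 inE.
have cardS' : (#|S :\ s| <= n)%N by move: cardS; rewrite (cardsD1 s S) sS.
have [As0|As0] := eqVneq (A s s) 0.
  apply: (IH A (S :\ s)) => // p q; rewrite !inE negb_and negbK.
  by case/orP => [/eqP ->|/suppA //]; apply: psd_diag_eq0.
have Asp : 0 < A s s by rewrite lt_def As0 psd_diag_ge0.
(* Schur complement of the pivot [s]: its row and column at [s] are zero. *)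
pose B p q := A p q - A s p * A s q / A s s.
have [||||L HL] := IH B (S :\ s) => //.
- move=> p q; rewrite !inE negb_and negbK /B => /orP[/eqP ->|pS].
    by field.
  by rewrite (symA s p) (suppA p q pS) (suppA p s pS) !mul0r subr0.
- by move=> p q; rewrite /B symA; congr (_ - _); rewrite mulrAC -!mulrA; ring.
- move=> a.
  (* This shift minimises the form of [A] over the coordinate [s], and the minimum is the form of
     [B] at [a]. *)
  have := psdA (fun p => a p + (- (\sum_p a p * A s p) / A s s) * (p == s)%:R).
  rewrite qform_shift //; congr (0 <= _).
  set l := \sum_p _.
  have -> : qform B a = qform A a - l ^+ 2 / A s s.
    rewrite /qform /B.
    under eq_bigr => p _.
      under eq_bigr => q _ do rewrite mulrBr.
      rewrite sumrB; over.
    rewrite sumrB; congr (_ - _).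
    rewrite expr2 {1}/l mulr_suml mulr_suml; apply: eq_bigr => p _.
    rewrite /l mulr_sumr mulr_suml; apply: eq_bigr => q _; ring.
  by field.
exists ((fun p => A s p / Num.sqrt (A s s)) :: L) => p q.
rewrite big_cons -HL /B.
rewrite (_ : _ / _ * _ = A s p * A s q / (Num.sqrt (A s s) ^+ 2)); last first.
  by rewrite expr2 invfM; ring.
by rewrite sqr_sqrtr ?ltW // addrC subrK.
Qed.

End Gram.

(** * Sesquilinear forms over complex matrices *)

Section Forms.
Variable R : rcfType.
Local Notation C := R[i].

Definition adj m n (A : 'M[C]_(m, n)) : 'M[C]_(n, m) := map_mx (@conjc R) A^T.

Lemma adjM m n p (A : 'M[C]_(m, n)) (B : 'M[C]_(n, p)) :
  adj (A *m B) = adj B *m adj A.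
Proof. by rewrite /adj trmx_mul map_mxM. Qed.

Lemma adjK m n (A : 'M[C]_(m, n)) : adj (adj A) = A.
Proof. by apply/matrixP => i j; rewrite !mxE conjcK. Qed.

Definition sform n (X : 'M[C]_n) (u v : 'cV[C]_n) : C := (adj u *m X *m v) 0 0.
Definition reform n (X : 'M[C]_n) u v : R := complex.Re (sform X u v).
Definition imform n (X : 'M[C]_n) u : R := complex.Im (sform X u u).
Definition sqn (x : C) : R := complex.Re x ^+ 2 + complex.Im x ^+ 2.
Definition sqnv n (u : 'cV[C]_n) : R := \sum_i sqn (u i 0).

Lemma sqn_ge0 x : 0 <= sqn x.
Proof. by rewrite addr_ge0 ?sqr_ge0. Qed.

Lemma sqnv_ge0 n (u : 'cV[C]_n) : 0 <= sqnv u.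
Proof. by rewrite sumr_ge0 // => i _; apply: sqn_ge0. Qed.

Lemma sqnv_eq0 n (u : 'cV[C]_n) : sqnv u = 0 -> u = 0.
Proof.
move=> /eqP; rewrite psumr_eq0 => [/allP H|i _]; last exact: sqn_ge0.
apply/colP => i; have := H i; rewrite mem_index_enum => /(_ isT) /=.
rewrite mxE /sqn paddr_eq0 ?sqr_ge0 // !sqrf_eq0 => /andP[/eqP r0 /eqP i0].
by case: (u i 0) r0 i0 => a b /= -> ->.
Qed.

Lemma sformE n (X : 'M[C]_n) u v :
  sform X u v = \sum_i \sum_j (u i 0)^* * X i j * v j 0.
Proof.
rewrite /sform !mxE exchange_big /=; apply: eq_bigr => j _.
by rewrite !mxE mulr_suml; apply: eq_bigr => i _; rewrite !mxE.
Qed.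

Lemma sformM n (A X B : 'M[C]_n) u v :
  sform (A *m X *m B) u v = sform X (adj A *m u) (B *m v).
Proof. by rewrite /sform adjM adjK !mulmxA. Qed.

Lemma sform_adj n (X : 'M[C]_n) u v : sform (adj X) u v = (sform X v u)^*.
Proof.
rewrite /sform; have -> : adj u *m adj X *m v = adj (adj v *m X *m u).
  by rewrite !adjM adjK mulmxA.
by rewrite !mxE.
Qed.

Lemma sformD n (X Y : 'M[C]_n) u v : sform (X + Y) u v = sform X u v + sform Y u v.
Proof. by rewrite /sform mulmxDr mulmxDl mxE. Qed.

Lemma sformN n (X : 'M[C]_n) u v : sform (- X) u v = - sform X u v.
Proof. by rewrite /sform mulmxN mulNmx mxE. Qed.

Lemma sformZ n a (X : 'M[C]_n) u v : sform (a *: X) u v = a * sform X u v.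
Proof. by rewrite /sform -scalemxAr -scalemxAl mxE. Qed.

Lemma sformZr n a (X : 'M[C]_n) u v : sform X u (a *: v) = a * sform X u v.
Proof. by rewrite /sform -scalemxAr mxE. Qed.

Lemma sform_sum n (T : Type) (s : seq T) (F : T -> 'M[C]_n) u v :
  sform (\sum_(f <- s) F f) u v = \sum_(f <- s) sform (F f) u v.
Proof.
elim: s => [|f s IH]; last by rewrite !big_cons sformD IH.
by rewrite !big_nil /sform mulmx0 mul0mx mxE.
Qed.

Lemma sform_delta n (X : 'M[C]_n) i j :
  sform X (delta_mx i 0) (delta_mx j 0) = X i j.
Proof.
have -> : sform X (delta_mx i 0) (delta_mx j 0) =
    ((delta_mx 0 i : 'rV_n) *m X *m (delta_mx j 0 : 'cV_n)) 0 0.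
  by rewrite /sform /adj trmx_delta map_delta_mx.
by rewrite -rowE -colE !mxE.
Qed.

Lemma sform1 n (u : 'cV[C]_n) : sform 1%:M u u = (sqnv u)%:C.
Proof.
rewrite /sform mulmx1 !mxE /sqnv rmorph_sum /=; apply: eq_bigr => i _.
by rewrite !mxE; case: (u i 0) => a b; rewrite /sqn /=; simpc; congr (_ +i* _); ring.
Qed.

(** From [A F = 1] comes [F^* A F = F^*], and passing to the adjoint flips the sign of the imaginary
    form. The variant below uses [F A F^* = F^*] instead. *)
Lemma imform_inv n (A F : 'M[C]_n) u : A *m F = 1%:M ->
  imform F u = - imform A (F *m u).
Proof.
move=> AF; have := sformM (adj F) A F u u.
rewrite adjK -mulmxA AF mulmx1 sform_adj /imform => <-.
by case: (sform _ _ _) => a b /=; rewrite opprK.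
Qed.

Lemma imform_inv_adj n (A F : 'M[C]_n) u : A *m F = 1%:M ->
  imform F u = - imform A (adj F *m u).
Proof.
move=> /mulmx1C FA; have := sformM F A (adj F) u u.
rewrite FA mul1mx sform_adj /imform => <-.
by case: (sform _ _ _) => a b /=; rewrite opprK.
Qed.

Lemma imform_delta n (X : 'M[C]_n) i : imform X (delta_mx i 0) = complex.Im (X i i).
Proof. by rewrite /imform sform_delta. Qed.

Lemma sqr_Im_le_sqn (x : C) : complex.Im x ^+ 2 <= sqn x.
Proof. by rewrite lerDr sqr_ge0. Qed.

(** For the column [w = F e_j], dissipativity gives [eta |w|^2 <= Im F_jj <= |w|], hence
    [|w| <= 1 / eta], which bounds every entry of the column. *)
Lemma sqn_inv_le n (A F : 'M[C]_n) (eta : R) i j : 0 < eta -> A *m F = 1%:M ->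
  (forall w, eta * sqnv w <= - imform A w) -> sqn (F i j) <= (eta^-1) ^+ 2.
Proof.
move=> eta0 AF dissA.
have := dissA (F *m delta_mx j 0); rewrite -imform_inv // imform_delta.
set w := F *m _ => le_w.
have wE k : w k 0 = F k j by rewrite /w -colE mxE.
have le_sqn k : sqn (F k j) <= sqnv w.
  rewrite -wE /sqnv (bigD1 k) //= lerDl sumr_ge0 // => l _; exact: sqn_ge0.
have ys := le_trans (sqr_Im_le_sqn (F j j)) (le_sqn j).
apply: le_trans (le_sqn i) _.
have eta1 : eta * eta^-1 = 1 by rewrite divff // gt_eqF.
have ei0 : 0 < eta^-1 by rewrite invr_gt0.
move: eta1 ei0 le_w (sqnv_ge0 w) ys.
set e := eta^-1; set s := sqnv w; set y := complex.Im _.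
move=> eta1 ei0 le_w s0 ys.
have ye : s <= e * y.
  by have := ler_wpM2l (ltW ei0) le_w; rewrite mulrA (mulrC e eta) eta1 mul1r.
(* Here [y ^+ 2 <= s <= e * y]; then [s <= e * y <= e ^+ 2]. *)
have : y <= e by nra.
nra.
Qed.

(** On a vector of the left kernel the form of [A] vanishes, so dissipativity forces its norm to be
    zero. *)
Lemma dissipative_unitmx n (A : 'M[C]_n) (eta : R) : 0 < eta ->
  (forall w, eta * sqnv w <= - imform A w) -> A \in unitmx.
Proof.
move=> eta0 dissA; rewrite -row_free_unit; apply: inj_row_free => v vA.
have : imform A (adj v) = 0 by rewrite /imform /sform adjK vA mul0mx mxE.
have := dissA (adj v) => /[swap] ->; rewrite oppr0 pmulr_rle0 // => le0.
have /sqnv_eq0 : sqnv (adj v) = 0 by apply/eqP; rewrite eq_le le0 sqnv_ge0.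
by move=> av; rewrite -[v]adjK av; apply/matrixP => i j; rewrite !mxE conjc0.
Qed.

(** Rotating the second argument by [-i] turns the imaginary part into a real part, so a bound on
    [reform] also bounds [imform]. *)
Lemma imform_reform n (X : 'M[C]_n) u : imform X u = reform X u ((-'i) *: u).
Proof.
by rewrite /imform /reform sformZr; case: (sform X u u) => a b; simpc.
Qed.

Lemma sqnvZi n (u : 'cV[C]_n) : sqnv ((-'i) *: u) = sqnv u.
Proof.
apply: eq_bigr => i _; rewrite !mxE; case: (u i 0) => a b.
by rewrite /sqn; simpc; rewrite /=; ring.
Qed.

Lemma sqr_normc_sqn (x : C) : normc x ^+ 2 = sqn x.
Proof. by case: x => a b; rewrite /normc sqr_sqrtr // addr_ge0 ?sqr_ge0. Qed.

Lemma normc_ge0 (x : C) : 0 <= normc x.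
Proof. by case: x => a b; apply: sqrtr_ge0. Qed.

Lemma ler_Re_normc (x : C) : complex.Re x <= normc x.
Proof.
apply: le_trans (ler_norm _) _; rewrite -ler_sqr ?nnegrE ?normc_ge0 //.
by rewrite sqr_normc_sqn real_normK ?num_real // lerDl sqr_ge0.
Qed.

Lemma normc_conj (x : C) : normc x^* = normc x.
Proof. by case: x => a b; rewrite /= sqrrN. Qed.

Lemma normc_real (a : R) : normc a%:C = `|a|.
Proof. by rewrite /= expr0n /= addr0 sqrtr_sqr. Qed.

Lemma Re_real_mul (k : R) (x : C) : complex.Re (k%:C * x) = k * complex.Re x.
Proof. by case: x => a b /=; rewrite mul0r subr0. Qed.

Lemma Im_real_mul (k : R) (x : C) : complex.Im (k%:C * x) = k * complex.Im x.
Proof. by case: x => a b /=; rewrite mul0r addr0. Qed.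

Lemma ReD (x y : C) : complex.Re (x + y) = complex.Re x + complex.Re y.
Proof. by case: x y => [a b] [c d]. Qed.

Lemma ImD (x y : C) : complex.Im (x + y) = complex.Im x + complex.Im y.
Proof. by case: x y => [a b] [c d]. Qed.

Lemma Re_sum (T : Type) (s : seq T) (F : T -> C) :
  complex.Re (\sum_(i <- s) F i) = \sum_(i <- s) complex.Re (F i).
Proof. by elim: s => [|i s IH]; rewrite ?big_nil // !big_cons ReD IH. Qed.

Lemma Im_sum (T : Type) (s : seq T) (F : T -> C) :
  complex.Im (\sum_(i <- s) F i) = \sum_(i <- s) complex.Im (F i).
Proof. by elim: s => [|i s IH]; rewrite ?big_nil // !big_cons ImD IH. Qed.

Lemma normc_Im_le (x : C) : complex.Im x <= normc x.
Proof.
apply: le_trans (ler_norm _) _; rewrite -ler_sqr ?nnegrE ?normc_ge0 //.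
by rewrite sqr_normc_sqn real_normK ?num_real // sqr_Im_le_sqn.
Qed.

(** The phase turns a bound on a real part into a bound on a modulus. *)
Lemma complex_phase (x : C) : exists2 th : C, sqn th = 1 & complex.Re (th * x) = normc x.
Proof.
have [->|xN0] := eqVneq x 0.
  by exists 1; rewrite ?mulr0 ?normc0 // /sqn /= expr1n expr0n addr0.
have nN0 : normc x != 0 by apply: contraNneq xN0 => /eq0_normc ->.
have H := sqr_normc_sqn x.
exists ((complex.Re x / normc x) -i* (complex.Im x / normc x)).
  rewrite /sqn /= sqrrN !expr_div_n -mulrDl -/(sqn x) -sqr_normc_sqn divff //.
  by rewrite expf_neq0.
case: x nN0 {xN0} H => p q; set n := normc _ => nN0; rewrite /sqn /= => nE.
by apply: (mulIf nN0); rewrite -expr2 nE; field.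
Qed.

Lemma sformZl n a (X : 'M[C]_n) u v : sform X (a *: u) v = a^* * sform X u v.
Proof.
have -> : sform X (a *: u) v = ((a^* *: adj u) *m X *m v) 0 0.
  rewrite /sform; congr ((_ *m X *m v) 0 0).
  by apply/matrixP => i j; rewrite !mxE rmorphM.
by rewrite -!scalemxAl mxE.
Qed.

Lemma imformZ n (X : 'M[C]_n) th u : imform X (th *: u) = sqn th * imform X u.
Proof.
rewrite /imform sformZr sformZl; case: (sform X u u) th => p q [c d].
by rewrite /sqn /=; ring.
Qed.

End Forms.

(** * The self-energy operator *)

Section SelfEnergy.
Variables (R : rcfType) (N : nat) (xi : 'I_N -> 'I_N -> 'I_N -> 'I_N -> R).
Local Notation C := R[i].
Implicit Types (X Y P Q : 'M[C]_N) (u v : 'cV[C]_N).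

Definition selfen X : 'M[C]_N := \matrix_(i, k)
  ((N%:R^-1)%:C * \sum_j \sum_l (xi i j k l)%:C * X j l).

Lemma selfenD X Y : selfen (X + Y) = selfen X + selfen Y.
Proof.
apply/matrixP => i k; rewrite !mxE -mulrDr -big_split /=; congr (_ * _).
apply: eq_bigr => j _; rewrite -big_split /=; apply: eq_bigr => l _.
by rewrite mxE mulrDr.
Qed.

Lemma selfenN X : selfen (- X) = - selfen X.
Proof.
apply/matrixP => i k; rewrite !mxE -mulrN -sumrN; congr (_ * _).
apply: eq_bigr => j _; rewrite -sumrN; apply: eq_bigr => l _.
by rewrite mxE mulrN.
Qed.

(** * Complete positivity of the self-energy *)

Section CompletelyPositive.
Variable L : seq ('I_N * 'I_N -> R).
Hypothesis gram : forall i j k l, xi i j k l = \sum_(f <- L) f (i, j) * f (k, l).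

Definition gmx (f : 'I_N * 'I_N -> R) : 'M[C]_N := \matrix_(i, j) (f (i, j))%:C.

(** The Gram factorisation of the covariance is a Kraus decomposition: the self-energy becomes a
    positive multiple of a sum of congruences, each of which preserves positivity. *)
Lemma selfen_kraus X :
  selfen X = (N%:R^-1)%:C *: \sum_(f <- L) gmx f *m X *m adj (gmx f).
Proof.
apply/matrixP => i k; rewrite !mxE; congr (_ * _).
rewrite summxE.
have -> : \sum_(f <- L) (gmx f *m X *m adj (gmx f)) i k =
   \sum_(f <- L) \sum_j \sum_l (f (i, j) * f (k, l))%:C * X j l.
  apply: eq_bigr => f _; rewrite !mxE exchange_big /=; apply: eq_bigr => l _.
  rewrite !mxE mulr_suml; apply: eq_bigr => j _.
  by rewrite !mxE conjc_real rmorphM /= mulrAC.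
rewrite [RHS]exchange_big /=; apply: eq_bigr => j _.
rewrite [RHS]exchange_big /=; apply: eq_bigr => l _.
by rewrite gram -mulr_suml rmorph_sum.
Qed.

Lemma sform_selfen X u v : sform (selfen X) u v =
  (N%:R^-1)%:C * \sum_(f <- L) sform X (adj (gmx f) *m u) (adj (gmx f) *m v).
Proof.
rewrite selfen_kraus sformZ sform_sum; congr (_ * _).
by apply: eq_bigr => f _; rewrite sformM.
Qed.

Lemma reform_selfen X u v : reform (selfen X) u v =
  N%:R^-1 * \sum_(f <- L) reform X (adj (gmx f) *m u) (adj (gmx f) *m v).
Proof. by rewrite /reform sform_selfen Re_real_mul Re_sum. Qed.

Lemma imform_selfen X u : imform (selfen X) u =
  N%:R^-1 * \sum_(f <- L) imform X (adj (gmx f) *m u).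
Proof. by rewrite /imform sform_selfen Im_real_mul Im_sum. Qed.

Lemma imform_selfen_ge0 X u :
  (forall w, 0 <= imform X w) -> 0 <= imform (selfen X) u.
Proof.
by move=> X0; rewrite imform_selfen mulr_ge0 ?invr_ge0 // sumr_ge0.
Qed.

(* 2-positivity of the self-energy, in the form in which a block matrix
   [[P, X], [X^*, Q]] is replaced by its quadratic form. *)
Lemma selfen_2positive (t : R) X P Q :
  (forall u v, 2 * reform X u v <= t * (imform P u + imform Q v)) ->
  forall u v, 2 * reform (selfen X) u v <=
    t * (imform (selfen P) u + imform (selfen Q) v).
Proof.
move=> H u v; rewrite reform_selfen !imform_selfen -mulrDr [2 * _]mulrCA.
rewrite [t * _]mulrCA ler_wpM2l ?invr_ge0 //.
rewrite -big_split /= !mulr_sumr; apply: ler_sum => f _; exact: H.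
Qed.

(** Termwise [|ab| <= (a^2 + b^2) / 2] in the Gram sum bounds a covariance by the mean of two
    variances. *)
Lemma gram_abs_le1 i j k l : (forall i j, xi i j i j <= 1) -> `|xi i j k l| <= 1.
Proof.
move=> diag; have := diag i j; have := diag k l; rewrite !gram => H1 H2.
set a := \sum_(f <- L) f (k, l) * f (k, l) in H1.
set b := \sum_(f <- L) f (i, j) * f (i, j) in H2.
apply: le_trans (_ : (a + b) / 2 <= 1); last by lra.
rewrite -big_split /= mulr_suml; apply: le_trans (ler_norm_sum _ _ _) _.
apply: ler_sum => f _; have := sqr_ge0 (f (i, j) + f (k, l)).
have := sqr_ge0 (f (i, j) - f (k, l)) => ? ?.
rewrite ler_norml; apply/andP; split; nra.
Qed.

End CompletelyPositive.

(** * Bounds on the self-energy, uniform in the dimension, from the band structure *)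

Section Banded.
Variables (near : rel 'I_N) (w : R).
Hypothesis w0 : 0 <= w.
Hypothesis near_sym : symmetric near.
Hypothesis near_card : forall i, \sum_k (near i k)%:R <= w :> R.
Hypothesis xi_le1 : forall i j k l, `|xi i j k l| <= 1.
Hypothesis xi_near : forall i j k l, ~~ (near i k && near j l) -> xi i j k l = 0.

(** The sum over near pairs [(j, l)] has at most [N * w] terms, which the factor [1 / N] reduces to
    [w]; the sum over near pairs [(i, k)] of [|u_i|^2 + |v_k|^2] contributes the second factor
    [w]. *)
Lemma reform_selfen_le (x : R) X u v : 0 <= x ->
  (forall j l, normc (X j l) <= x) ->
  2 * reform (selfen X) u v <= w ^+ 2 * x * (sqnv u + sqnv v).
Proof.
move=> x0 Xx.
pose T i k : R := (near i k)%:R * (sqn (u i 0) + sqn (v k 0)).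
have T0 i k : 0 <= T i k by rewrite mulr_ge0 ?ler0n // addr_ge0 ?sqn_ge0.
(* For near pairs this is [2 |u_i| |v_k| <= |u_i|^2 + |v_k|^2]; otherwise the covariance is zero.
   The bound is a product, so the fourfold sum will factor. *)
have point i k j l : 2 * complex.Re ((u i 0)^* * ((xi i j k l)%:C * X j l) * v k 0)
    <= x * ((near j l)%:R * T i k).
  have [/andP[nik njl]|nn] := boolP (near i k && near j l); last first.
    rewrite (xi_near nn) mul0r mulr0 mul0r mulr0.
    by rewrite mulr_ge0 // mulr_ge0 ?ler0n.
  rewrite /T nik njl !mul1r.
  have := ler_Re_normc ((u i 0)^* * ((xi i j k l)%:C * X j l) * v k 0).
  rewrite !normcM normc_conj normc_real -!sqr_normc_sqn.
  have := xi_le1 i j k l; have := Xx j l.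
  have := normc_ge0 (u i 0); have := normc_ge0 (v k 0); have := normc_ge0 (X j l).
  have := normr_ge0 (xi i j k l).
  set a := normc (u i 0); set b := normc (v k 0); set y := normc (X j l).
  set c := `|_|; set re := complex.Re _ => c0 y0 b0 a0 yx c1 H.
  have cy : c * y <= x by nra.
  have ab : 0 <= a * b by rewrite mulr_ge0.
  have : a * (c * y) * b <= x * (a * b).
    by rewrite mulrAC [X in X <= _]mulrC ler_wpM2r.
  have : 0 <= x * (a - b) ^+ 2 by rewrite mulr_ge0 ?sqr_ge0.
  nra.
have -> : reform (selfen X) u v = N%:R^-1 * \sum_i \sum_k \sum_j \sum_l
    complex.Re ((u i 0)^* * ((xi i j k l)%:C * X j l) * v k 0).
  rewrite /reform sformE Re_sum mulr_sumr; apply: eq_bigr => i _.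
  rewrite Re_sum mulr_sumr; apply: eq_bigr => k _.
  rewrite mxE [_ * (_%:C * _)]mulrCA -mulrA Re_real_mul; congr (_ * _).
  rewrite mulr_sumr mulr_suml Re_sum; apply: eq_bigr => j _.
  by rewrite mulr_sumr mulr_suml Re_sum.
apply: (@le_trans _ _ (N%:R^-1 * \sum_i \sum_k \sum_j \sum_l
    x * ((near j l)%:R * T i k))).
  rewrite mulrCA ler_wpM2l ?invr_ge0 //.
  do 4 (rewrite mulr_sumr; apply: ler_sum => ? _); exact: point.
have nearN : \sum_j \sum_l (near j l)%:R <= N%:R * w.
  apply: le_trans (ler_sum _ (fun j _ => near_card j)) _.
  by rewrite sumr_const card_ord mulr_natl.
have TS : \sum_i \sum_k T i k <= w * (sqnv u + sqnv v).
  rewrite (eq_bigr (fun i => \sum_k (near i k)%:R * sqn (u i 0) +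
     \sum_k (near i k)%:R * sqn (v k 0))); last first.
    by move=> i _; rewrite -big_split; apply: eq_bigr => k _; rewrite /T mulrDr.
  rewrite big_split /= mulrDr lerD //.
    rewrite mulr_sumr; apply: ler_sum => i _.
    by rewrite -mulr_suml ler_wpM2r ?sqn_ge0.
  rewrite exchange_big mulr_sumr; apply: ler_sum => k _ /=.
  rewrite -mulr_suml ler_wpM2r ?sqn_ge0 //.
  by under eq_bigr => i _ do rewrite near_sym.
have -> : \sum_i \sum_k \sum_j \sum_l x * ((near j l)%:R * T i k) =
    x * ((\sum_j \sum_l (near j l)%:R) * \sum_i \sum_k T i k).
  rewrite !mulr_sumr; apply: eq_bigr => i _.
  rewrite !mulr_sumr; apply: eq_bigr => k _.
  rewrite mulr_suml mulr_sumr; apply: eq_bigr => j _.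
  by rewrite mulr_suml mulr_sumr; apply: eq_bigr => l _; rewrite mulrA.
have S0 : 0 <= sqnv u + sqnv v by rewrite addr_ge0 ?sqnv_ge0.
have TT0 : 0 <= \sum_i \sum_k T i k by rewrite sumr_ge0 // => i _; rewrite sumr_ge0.
(* Only an inequality, since for [N = 0] the inverse is [0] by convention and the product is [0]. *)
have : N%:R^-1 * N%:R <= 1 :> R.
  by case: (N) => [|n]; rewrite ?mulr0 ?ler01 // mulVf ?pnatr_eq0.
have Ni : 0 <= N%:R^-1 :> R by rewrite invr_ge0.
have n0 : 0 <= \sum_j \sum_l (near j l)%:R :> R.
  by rewrite sumr_ge0 // => i _; rewrite sumr_ge0.
move: nearN TS S0 TT0 Ni n0.
set n := \sum_j _; set s := \sum_i _; set S := sqnv u + _; set ni := N%:R^-1.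
move=> nearN TS S0 TT0 Ni n0 N1.
have : ni * n <= w.
  apply: le_trans (ler_wpM2l Ni nearN) _; rewrite mulrA ler_piMl //.
move=> nn; have {}n0 : 0 <= ni * n by rewrite mulr_ge0.
have -> : ni * (x * (n * s)) = x * ((ni * n) * s) by ring.
have -> : w ^+ 2 * x * S = x * (w * (w * S)) by ring.
by rewrite ler_wpM2l // ler_pM.
Qed.

Lemma imform_selfen_le (x : R) X u : 0 <= x ->
  (forall j l, normc (X j l) <= x) ->
  `|imform (selfen X) u| <= w ^+ 2 * x * sqnv u.
Proof.
move=> x0 Xx; have bnd Y : (forall j l, normc (Y j l) <= x) ->
    imform (selfen Y) u <= w ^+ 2 * x * sqnv u.
  move=> Yx; rewrite imform_reform.
  have := reform_selfen_le u ((-'i) *: u) x0 Yx; rewrite sqnvZi; lra.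
rewrite ler_norml bnd // andbT lerNl.
have <- : imform (selfen (- X)) u = - imform (selfen X) u.
  by rewrite selfenN /imform sformN; case: (sform _ _ _).
by apply: bnd => j l; rewrite mxE normcN.
Qed.

End Banded.
End SelfEnergy.

(** * Stability of the Dyson equation *)

(** The right-hand side is [(1 - k)] times the sum of the [k ^+ m] over [m < n], each at least
    [k ^+ n]. This gives a rate for the decay of [k ^+ n]. *)
Lemma natr_expr_le (R : realFieldType) (k : R) n : 0 <= k -> k < 1 ->
  n%:R * (1 - k) * k ^+ n <= 1 - k ^+ n.
Proof.
move=> k0 k1; elim: n => [|n IH]; first by rewrite expr0 subrr !mul0r.
have kn0 : 0 <= k ^+ n.+1 by rewrite exprn_ge0.
have kn1 : k ^+ n.+1 <= 1 by rewrite exprn_ile1 // ltW.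
rewrite -natr1.
have -> : (n%:R + 1) * (1 - k) * k ^+ n.+1 =
    k * (n%:R * (1 - k) * k ^+ n) + (1 - k) * k ^+ n.+1 by rewrite exprS; ring.
apply: le_trans (lerD (ler_wpM2l k0 IH) (lexx _)) _.
rewrite mulrBr mulr1 -exprS; nra.
Qed.

(** Passage to the limit by the Archimedean property: if [y < x], the decay rate of [k ^+ n] gives
    [n (1 - k) (x - y) <= w] for every [n]. *)
Lemma ler_add_geometric (R : realType) (k x y w : R) : 0 <= k -> k < 1 -> 0 <= w ->
  (forall n, x <= y + k ^+ n * w) -> x <= y.
Proof.
move=> k0 k1 w0 H; rewrite leNgt; apply/negP => yx.
pose d := (1 - k) * (x - y).
have d0 : 0 < d by rewrite mulr_gt0 ?subr_gt0.
(* This [n] exceeds [w / d]. *)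
have := archi_boundP (divr_ge0 w0 (ltW d0)); set n := Num.bound _.
rewrite ltr_pdivrMr // ltNge => /negP; apply.
have Hn : x - y <= k ^+ n * w by have := H n; lra.
have kn0 : 0 <= k ^+ n by rewrite exprn_ge0.
have -> : n%:R * d = n%:R * (1 - k) * (x - y) by rewrite mulrA.
apply: (@le_trans _ _ (n%:R * (1 - k) * (k ^+ n * w))).
  by rewrite ler_wpM2l // mulr_ge0 ?ler0n // subr_ge0 ltW.
rewrite mulrA ler_piMl //; apply: le_trans (natr_expr_le n k0 k1) _; lra.
Qed.

Section Stability.
Variables (R : realType) (N : nat) (xi : 'I_N -> 'I_N -> 'I_N -> 'I_N -> R).
Local Notation C := R[i].
Variables (near : rel 'I_N) (w : R) (L : seq ('I_N * 'I_N -> R)).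
Hypothesis w0 : 0 <= w.
Hypothesis near_sym : symmetric near.
Hypothesis near_card : forall i, \sum_k (near i k)%:R <= w :> R.
Hypothesis xi_diag : forall i j, xi i j i j <= 1.
Hypothesis xi_near : forall i j k l, ~~ (near i k && near j l) -> xi i j k l = 0.
Hypothesis gram : forall i j k l, xi i j k l = \sum_(f <- L) f (i, j) * f (k, l).
Variable z : C.
Let eta := complex.Im z.
Hypothesis eta0 : 0 < eta.

(** The matrix that [F] inverts: [F(X)] enters below only through equations
    [dyson X *m F = 1%:M]. *)
Definition dyson (X : 'M[C]_N) : 'M[C]_N := (- z)%:M - selfen xi X.

Lemma imform_dyson X u : - imform (dyson X) u = eta * sqnv u + imform (selfen xi X) u.
Proof.
rewrite /dyson /imform sformD sformN -scalemx1 sformZ sform1 !ImD.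
rewrite -[- z * _]mulrC Im_real_mul /eta.
case: (sform _ _ _) => a b; case: (z) => c d /=; ring.
Qed.

Lemma dyson_dissipative X : (forall u, 0 <= imform X u) ->
  forall u, eta * sqnv u <= - imform (dyson X) u.
Proof.
by move=> X0 u; rewrite imform_dyson lerDl (imform_selfen_ge0 gram).
Qed.

Lemma dyson_inv_le X F i j : (forall u, 0 <= imform X u) -> dyson X *m F = 1%:M ->
  normc (F i j) <= eta^-1.
Proof.
move=> X0 XF; rewrite -ler_sqr ?nnegrE ?normc_ge0 ?invr_ge0 ?(ltW eta0) //.
rewrite sqr_normc_sqn; exact: (sqn_inv_le _ _ eta0 XF (dyson_dissipative X0)).
Qed.

Let xi_le1 i j k l : `|xi i j k l| <= 1.
Proof. exact: (gram_abs_le1 gram). Qed.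

Variables (M M' F' Rm : 'M[C]_N) (r eps : R).
Hypothesis M_ge0 : forall u, 0 <= imform M u.
Hypothesis M'_ge0 : forall u, 0 <= imform M' u.
Hypothesis M_inv : dyson M *m M = 1%:M.
Hypothesis F'_inv : dyson M' *m F' = 1%:M.
Hypothesis M'E : M' = F' + Rm.
Hypothesis r0 : 0 <= r.
Hypothesis Rm_le : forall i j, normc (Rm i j) <= r.
Hypothesis r_eps : r <= eps.
Hypothesis eps_small : w ^+ 2 * eps <= eta / 2.

Let E := selfen xi (M' - M).
Let a u := - imform (dyson M) u.
Let b v := - imform (dyson M') v.
(** [Lam] bounds [a] and [b] against the squared norm, so [eta * sqnv u] is at least the fraction
    [2 * gam] of either form. Only [gam] is kept as the contraction gain, the other half being
    reserved for [Xi(R)]. [rho] is the cost of the source term [Xi(R)]. *)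
Let Lam := eta + w ^+ 2 * (eta^-1 + eps).
Let gam := eta / (2 * Lam).
Let rho := w ^+ 2 * r / eta.

Lemma dyson_resolvent : F' - M = M *m E *m F'.
Proof.
have -> : E = dyson M - dyson M'.
  by rewrite /E selfenD selfenN /dyson opprB [RHS]addrC addrA subrK.
by rewrite mulmxBr mulmxBl (mulmx1C M_inv) mul1mx -mulmxA F'_inv mulmx1.
Qed.

Lemma dyson_form_a u : a (adj M *m u) = imform M u.
Proof. by rewrite /a -imform_inv_adj. Qed.

Lemma dyson_form_b v : b (F' *m v) = imform F' v.
Proof. by rewrite /b -imform_inv. Qed.

Definition bounded_by (t : R) := forall u v, 2 * reform E u v <= t * (a u + b v).

(** Substituting [M^* u] and [F' v] turns [a] and [b] into the imaginary forms of [M] and [F'],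
    which is the shape of hypothesis that [selfen_2positive] takes. *)
Lemma bounded_by_resolvent t u v : bounded_by t ->
  2 * reform (M *m E *m F') u v <= t * (imform M u + imform F' v).
Proof.
move=> Ht; have := Ht (adj M *m u) (F' *m v).
by rewrite dyson_form_a dyson_form_b /reform sformM.
Qed.

Let a_ge u : eta * sqnv u <= a u. Proof. exact: dyson_dissipative. Qed.
Let b_ge u : eta * sqnv u <= b u. Proof. exact: dyson_dissipative. Qed.

Let eps0 : 0 <= eps := le_trans r0 r_eps.
Let ei0 : 0 < eta^-1. Proof. by rewrite invr_gt0. Qed.
Let w20 : 0 <= w ^+ 2. Proof. exact: sqr_ge0. Qed.

Lemma normc_dyson_le i j : normc (M i j) <= eta^-1.
Proof. exact: dyson_inv_le M_inv. Qed.

Lemma normc_dyson'_le i j : normc (F' i j) <= eta^-1.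
Proof. exact: dyson_inv_le F'_inv. Qed.

Lemma normc_perturbed_le i j : normc (M' i j) <= eta^-1 + r.
Proof.
rewrite M'E mxE; apply: le_trans (le_normcD _ _) _.
by rewrite lerD ?normc_dyson'_le.
Qed.

Let imform_le := imform_selfen_le w0 near_sym near_card xi_le1 xi_near.
Let reform_le := reform_selfen_le w0 near_sym near_card xi_le1 xi_near.

(** The entries of [M] are at most [eta^-1]; the weaker bound [eta^-1 + eps] lets [a] and [b] share
    the constant [Lam]. *)
Let a_le u : a u <= Lam * sqnv u.
Proof.
rewrite /a imform_dyson mulrDl lerD2l.
have e0 : 0 <= eta^-1 + eps by rewrite addr_ge0 // ltW.
apply: le_trans (ler_norm _) (imform_le _ e0 _) => i j.
by apply: le_trans (normc_dyson_le i j) _; rewrite lerDl.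
Qed.

Let b_le u : b u <= Lam * sqnv u.
Proof.
rewrite /b imform_dyson mulrDl lerD2l.
have e0 : 0 <= eta^-1 + eps by rewrite addr_ge0 // ltW.
apply: le_trans (ler_norm _) (imform_le _ e0 _) => i j.
by apply: le_trans (normc_perturbed_le i j) _; rewrite lerD2l.
Qed.

Let Lam0 : 0 < Lam.
Proof. by rewrite ltr_wpDr // mulr_ge0 // addr_ge0 // ltW. Qed.

Let gam0 : 0 < gam. Proof. by rewrite divr_gt0 ?mulr_gt0. Qed.

Let gam1 : gam <= 1.
Proof.
rewrite ler_pdivrMr ?mulr_gt0 // mul1r /Lam.
have : 0 <= w ^+ 2 * (eta^-1 + eps) by rewrite mulr_ge0 // addr_ge0 // ltW.
move: eta0; lra.
Qed.

Let gamE (x : R) : gam * (Lam * x) = eta / 2 * x.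
Proof. by rewrite /gam; field; rewrite gt_eqF. Qed.

Let form_le c u v : 0 <= c -> c * (sqnv u + sqnv v) <= c / eta * (a u + b v).
Proof.
move=> c0; have -> : c * (sqnv u + sqnv v) = c / eta * (eta * (sqnv u + sqnv v)).
  by field; rewrite gt_eqF.
by rewrite ler_wpM2l ?divr_ge0 ?(ltW eta0) // mulrDr lerD.
Qed.

Lemma bounded_by_step t : 0 <= t -> bounded_by t ->
  bounded_by ((1 - gam) * t + rho).
Proof.
move=> t0 Ht u v.
have DE : M' - M = M *m E *m F' + Rm by rewrite -dyson_resolvent M'E addrAC.
have -> : reform E u v = reform (selfen xi (M *m E *m F')) u v +
    reform (selfen xi Rm) u v.
  by rewrite {1}/E DE selfenD /reform sformD ReD.
have H1 := selfen_2positive gram (fun u v => bounded_by_resolvent u v Ht) u v.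
have H2 := reform_le u v r0 Rm_le.
have aE : imform (selfen xi M) u = a u - eta * sqnv u.
  by rewrite /a imform_dyson addrAC subrr add0r.
(* [b] is built from [M' = F' + R], so [Xi(R)] appears as a correction. *)
have bE : imform (selfen xi F') v = b v - eta * sqnv v - imform (selfen xi Rm) v.
  rewrite /b imform_dyson (_ : F' = M' - Rm); last by rewrite M'E addrK.
  by rewrite selfenD selfenN /imform sformD sformN ImD; case: (sform _ v v) => ? ?;
     case: (sform (selfen xi Rm) v v) => ? ? /=; ring.
(* By [eps_small] this correction costs at most half of [eta * sqnv v]. *)
have H3 : - imform (selfen xi Rm) v <= eta / 2 * sqnv v.
  apply: le_trans (_ : w ^+ 2 * r * sqnv v <= _).
    by have := imform_le v r0 Rm_le; rewrite ler_norml => /andP[]; lra.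
  by rewrite ler_wpM2r ?sqnv_ge0 //; apply: le_trans eps_small; rewrite ler_wpM2l.
have H4 : imform (selfen xi M) u <= (1 - gam) * a u.
  have := ler_wpM2l (ltW gam0) (a_le u); rewrite gamE aE mulrBl mul1r.
  have : 0 <= eta * sqnv u by rewrite mulr_ge0 ?sqnv_ge0 // ltW.
  lra.
(* Both halves of [eta * sqnv v] are spent: one absorbs [Xi(R)], the other dominates [gam * b v]. *)
have H5 : imform (selfen xi F') v <= (1 - gam) * b v.
  have := ler_wpM2l (ltW gam0) (b_le v); rewrite gamE bE mulrBl mul1r.
  lra.
have H6 : w ^+ 2 * r * (sqnv u + sqnv v) <= rho * (a u + b v).
  by apply: form_le; rewrite mulr_ge0.
rewrite [leLHS]mulrDr [leRHS]mulrDl; apply: lerD; last exact: le_trans H2 H6.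
apply: le_trans H1 _; rewrite [_ * t]mulrC -mulrA ler_wpM2l // mulrDr.
exact: lerD.
Qed.

Let ab0 u v : 0 <= a u + b v.
Proof.
rewrite addr_ge0 //; [apply: le_trans (a_ge u)|apply: le_trans (b_ge v)];
by rewrite mulr_ge0 ?sqnv_ge0 // ltW.
Qed.

(** The value [rho / gam] is the fixed point of [t -> (1 - gam) t + rho]. Iterating
    [bounded_by_step] from a crude bound converges to it geometrically, so the existence of a least
    [t] need not be shown. *)
Lemma bounded_by_limit : bounded_by (rho / gam).
Proof.
(* Crude bound on the entries of [M' - M], adding those for [M'] and [M]; it affects only the
   starting point [t0], not the limit. *)
pose d := eta^-1 + r + eta^-1.
have d0 : 0 <= d by rewrite !addr_ge0 // ltW.
pose t0 := w ^+ 2 * d / eta.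
have t00 : 0 <= t0 by rewrite divr_ge0 ?mulr_ge0 // ltW.
have rg0 : 0 <= rho / gam by rewrite divr_ge0 ?(ltW gam0) // divr_ge0 ?mulr_ge0 // ltW.
have k0 : 0 <= 1 - gam by rewrite subr_ge0.
have base : bounded_by t0.
  move=> u v; apply: le_trans (reform_le u v d0 _) _ => [i j|].
    rewrite !mxE; apply: le_trans (le_normcD _ _) _.
    by rewrite normcN lerD ?normc_dyson_le ?normc_perturbed_le.
  by apply: form_le; rewrite mulr_ge0.
have iter n : bounded_by (rho / gam + (1 - gam) ^+ n * t0).
  elim: n => [|n IH].
    move=> u v; apply: le_trans (base u v) _.
    by rewrite ler_wpM2r // expr0 mul1r lerDr.
  have -> : rho / gam + (1 - gam) ^+ n.+1 * t0 =
      (1 - gam) * (rho / gam + (1 - gam) ^+ n * t0) + rho.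
    by rewrite exprS; field; rewrite gt_eqF.
  by apply: bounded_by_step => //; rewrite addr_ge0 // mulr_ge0 // exprn_ge0.
move=> u v; apply: (@ler_add_geometric _ (1 - gam) _ _ (t0 * (a u + b v))) => //.
- by move: gam0; lra.
- by rewrite mulr_ge0.
- by move=> n; rewrite mulrA -mulrDl; apply: iter.
Qed.

Lemma dyson_stability i j :
  normc ((M' - M) i j) <= (w ^+ 2 / (eta ^+ 2 * gam) + 1) * r.
Proof.
have DE : M' - M = M *m E *m F' + Rm by rewrite -dyson_resolvent M'E addrAC.
rewrite DE mxE mulrDl mul1r; apply: le_trans (le_normcD _ _) _; rewrite lerD //.
set x := (M *m E *m F') i j.
have rg0 : 0 <= rho / gam by rewrite divr_ge0 ?(ltW gam0) // divr_ge0 ?mulr_ge0 // ltW.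
have -> : w ^+ 2 / (eta ^+ 2 * gam) * r = rho / gam * eta^-1.
  by rewrite /rho; field; rewrite !gt_eqF.
have [th th1 thx] := complex_phase x.
(* Basis vectors isolate the entry [x], and the phase makes its real part [|x|]. The bound reads [2
   |x| <= t (Im M_ii + Im F'_jj) <= 2 t / eta] with [t = rho / gam]. *)
have := bounded_by_resolvent (delta_mx i 0) (th *: delta_mx j 0) bounded_by_limit.
rewrite imformZ th1 mul1r !imform_delta /reform sformZr sform_delta thx => H.
have Ms := le_trans (normc_Im_le _) (normc_dyson_le i i).
have Fs := le_trans (normc_Im_le _) (normc_dyson'_le j j).
have := ler_wpM2l rg0 (lerD Ms Fs); lra.
Qed.

End Stability.

(** * Transfer to the concrete matrices *)

Local Notation R := Rdefinitions.R.
Local Notation C := R[i].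

Definition toC (x : Cplx) : C := re x +i* im x.
Definition ofC (x : C) : Cplx := mkC (complex.Re x) (complex.Im x).

Lemma ofCK : cancel ofC toC. Proof. by case. Qed.
Lemma toCK : cancel toC ofC. Proof. by case. Qed.

Lemma toC_add x y : toC (Cadd x y) = toC x + toC y. Proof. by []. Qed.
Lemma toC_opp x : toC (Copp x) = - toC x. Proof. by []. Qed.
Lemma toC_sub x y : toC (Csub x y) = toC x - toC y. Proof. by []. Qed.
Lemma toC_mul x y : toC (Cmul x y) = toC x * toC y. Proof. by []. Qed.
Lemma toC_conj x : toC (Cconj x) = (toC x)^*. Proof. by []. Qed.

Lemma toC_csum n f : toC (csum n f) = \sum_(i < n) toC (f i).
Proof.
by elim: n => [|n IH]; rewrite ?big_ord0 // big_ord_recr /= toC_add IH.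
Qed.

Lemma rsumE n f : rsum n f = \sum_(i < n) f i.
Proof. by elim: n => [|n IH]; rewrite ?big_ord0 // big_ord_recr /= IH. Qed.

Lemma CabsE x : Cabs x = normc (toC x).
Proof. by rewrite /Cabs RsqrtE. Qed.

Definition mx N (A : Mat) : 'M[C]_N := \matrix_(i, j) toC (A i j).

Definition ofmx N (B : 'M[C]_N) : Mat := fun i j =>
  match insub i : option 'I_N, insub j : option 'I_N with
  | Some i', Some j' => ofC (B i' j') | _, _ => C0 end.

Lemma ofmxK N : cancel (@ofmx N) (@mx N).
Proof. by move=> B; apply/matrixP => i j; rewrite mxE /ofmx !valK ofCK. Qed.

Lemma mx_mul N A B : mx N (Mmul N A B) = mx N A *m mx N B.
Proof.
apply/matrixP => i j; rewrite !mxE toC_csum; apply: eq_bigr => k _.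
by rewrite !mxE toC_mul.
Qed.

Lemma eqbE (i j : nat) : Nat.eqb i j = (i == j).
Proof. by apply/idP/eqP => [/PeanoNat.Nat.eqb_eq|->]; rewrite ?PeanoNat.Nat.eqb_refl. Qed.

Lemma lebE (i j : nat) : Nat.leb i j = (i <= j)%N.
Proof.
by apply/idP/idP => [/PeanoNat.Nat.leb_le/ssrnat.leP|/ssrnat.leP/PeanoNat.Nat.leb_le].
Qed.

Lemma ltbE (i j : nat) : Nat.ltb i j = (i < j)%N.
Proof. by rewrite /Nat.ltb lebE. Qed.

Lemma mx_id N : mx N Mid = 1%:M.
Proof.
apply/matrixP => i j; rewrite !mxE /Mid eqbE -val_eqE /=.
by case: eqP.
Qed.

Lemma mx_eq N A B : Meq N A B <-> mx N A = mx N B.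
Proof.
split=> [H|/matrixP H i j /ssrnat.ltP iN /ssrnat.ltP jN].
  by apply/matrixP => i j; rewrite !mxE H //; apply/ssrnat.ltP.
by have := H (Ordinal iN) (Ordinal jN); rewrite !mxE => /(can_inj toCK).
Qed.

(** [Minv] is a choice, meaningful once some inverse exists; [invmx], carried back by [ofmx], is the
    witness. *)
Lemma mx_inv N A : mx N A \in unitmx -> mx N A *m mx N (Minv N A) = 1%:M.
Proof.
move=> Au; have : is_inverse N A (Minv N A).
  apply: epsilon_spec; exists (ofmx (invmx (mx N A))).
  by split; apply/mx_eq; rewrite mx_mul ofmxK mx_id ?mulmxV ?mulVmx.
by case=> /mx_eq; rewrite mx_mul mx_id.
Qed.

Lemma mx_sub N A B : mx N (Msub A B) = mx N A - mx N B.
Proof. by apply/matrixP => i j; rewrite !mxE toC_sub. Qed.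

Lemma mx_add N A B : mx N (Madd A B) = mx N A + mx N B.
Proof. by apply/matrixP => i j; rewrite !mxE toC_add. Qed.

Lemma mx_Im N M : mx N (Defs.ImM M) = (- (2^-1)%:C * 'i) *: (mx N M - adj (mx N M)).
Proof.
apply/matrixP => i j; rewrite !mxE /Defs.ImM toC_mul toC_sub toC_conj; congr (_ * _).
by simpc; rewrite /toC /=; congr (_ +i* _); rewrite ?mulr1 ?RinvE.
Qed.

Lemma rmaxn_ge n f i : (i < n)%N -> f i <= rmaxn n f.
Proof.
elim: n => // n IH; rewrite ltnS leq_eqVlt /= RmaxE le_max => /orP[/eqP ->|/IH ->] //.
by rewrite lexx orbT.
Qed.

Lemma rmaxn_le n f x : 0 <= x -> (forall i, (i < n)%N -> f i <= x) -> rmaxn n f <= x.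
Proof.
move=> x0; elim: n => //= n IH H; rewrite RmaxE ge_max IH ?H // => i iN.
by rewrite H // ltnS ltnW.
Qed.

Lemma rmaxn_ge0 n f : (forall i, 0 <= f i) -> 0 <= rmaxn n f.
Proof. by move=> f0; elim: n => //= n IH; rewrite RmaxE le_max IH. Qed.

Lemma Cabs_ge0 x : 0 <= Cabs x.
Proof. by rewrite CabsE normc_ge0. Qed.

Lemma supnorm_ge0 N A : 0 <= supnorm N A.
Proof. by apply: rmaxn_ge0 => i; apply: rmaxn_ge0 => j; apply: Cabs_ge0. Qed.

Lemma normc_mx_le N A i j : normc (mx N A i j) <= supnorm N A.
Proof.
rewrite mxE -CabsE; apply: le_trans (rmaxn_ge _ (ltn_ord i)).
exact: (rmaxn_ge (fun j => Cabs (A i j)) (ltn_ord j)).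
Qed.

Lemma supnorm_le N A x : 0 <= x -> (forall i j, normc (mx N A i j) <= x) ->
  supnorm N A <= x.
Proof.
move=> x0 H; apply: rmaxn_le => // i iN; apply: rmaxn_le => // j jN.
by have := H (Ordinal iN) (Ordinal jN); rewrite mxE CabsE.
Qed.

Lemma Mplus_imform N M u : Mplus N M -> 0 <= imform (mx N M) u.
Proof.
move=> MP; have [->|uN0] := eqVneq u 0.
  by rewrite /imform /sform mulmx0 mxE.
(* [Mplus] tests vectors indexed by all naturals, so [u] is extended by zero. *)
pose v i := if insub i : option 'I_N is Some i' then ofC (u i' 0) else C0.
have vN0 : exists i, (i < N)%coq_nat /\ v i <> C0.
  have [i ui] : exists i, u i 0 != 0.
    apply/existsP; apply: contraNT uN0; rewrite negb_exists => /forallP H.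
    by apply/eqP/colP => i; rewrite mxE; apply/eqP; have := H i; rewrite negbK.
  exists i; split; first exact/ssrnat.ltP.
  by rewrite /v valK => /(congr1 toC); rewrite ofCK => /eqP; rewrite (negPf ui).
have /RltP/ltW := MP v vN0.
have -> : 0 <= imform (mx N M) u = (0 <= complex.Re (sform (mx N (Defs.ImM M)) u u)).
  rewrite mx_Im sformZ sformD sformN sform_adj /imform.
  by case: (sform _ u u) => a b /=; congr (0 <= _); field.
congr (0 <= _); rewrite -[LHS]/(complex.Re (toC _)) toC_csum sformE; congr complex.Re.
apply: eq_bigr => i _; rewrite toC_csum; apply: eq_bigr => j _.
by rewrite !toC_mul toC_conj /v !valK !ofCK mxE mulrA.
Qed.

Definition xi_ord N cov (i j k l : 'I_N) : R := xi cov i j k l.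

Lemma mx_Xi N cov M : mx N (Xi N cov M) = selfen (xi_ord (N:=N) cov) (mx N M).
Proof.
apply/matrixP => i k; rewrite !mxE /Xi toC_mul toC_csum; congr (_ * _).
  by rewrite /toC /= INRE.
apply: eq_bigr => j _; rewrite toC_csum; apply: eq_bigr => l _.
by rewrite toC_mul !mxE.
Qed.

Lemma mx_dyson N cov z M :
  mx N (fun i k => Csub (Cmul (Copp z) (Mid i k)) (Xi N cov M i k)) =
  dyson (xi_ord (N:=N) cov) (toC z) (mx N M).
Proof.
rewrite /dyson -mx_Xi; apply/matrixP => i k.
rewrite -scalemx1 -mx_id !mxE toC_sub toC_mul toC_opp; by [].
Qed.

(** * Admissible covariances satisfy the abstract hypotheses *)

Section Covariance.
Variables (K N : nat) (cov : nat -> nat -> nat -> nat -> R).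
Hypothesis adm : cov_admissible K N cov.

Lemma xi_sym (i j k l : 'I_N) : xi_ord cov i j k l = xi_ord cov k l i j.
Proof.
case: adm => sym _; rewrite /xi_ord /xi !lebE !ltbE.
have [ij|ij] := leqP i j; have [kl|kl] := leqP k l; rewrite //=.
- by apply: sym; apply/ssrnat.leP.
- by apply: sym; apply/ssrnat.leP => //; apply: ltnW.
Qed.

Lemma xi_diag_le1 (i j : 'I_N) : xi_ord cov i j i j <= 1.
Proof.
case: adm => _ [_ [diag _]]; rewrite /xi_ord /xi !lebE !ltbE andbb.
have [ij|ij] := leqP i j => /=; apply/RleP; apply: diag; apply/ssrnat.leP => //.
exact: ltnW.
Qed.

Definition near (i k : 'I_N) := (natdist i k <= K)%N.

Lemma near_sym : symmetric near.
Proof. by move=> i k; rewrite /near /natdist; congr (_ <= _)%N; lia. Qed.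

Lemma xi_far (i j k l : 'I_N) : ~~ (near i k && near j l) -> xi_ord cov i j k l = 0.
Proof.
case: adm => _ [_ [_ far]] nn.
have Kd : (K < maxn (natdist i k) (natdist j l))%N.
  by rewrite leq_max !ltnNge -negb_and.
have maxE a b : Nat.max a b = maxn a b by lia.
rewrite /xi_ord /xi !lebE !ltbE.
have [ij|ij] := leqP i j; have [kl|kl] := leqP k l; rewrite //=.
  by apply: far; rewrite ?maxE; apply/ssrnat.leP.
(* Below the diagonal the entry is [cov j i l k], so the two distances trade places. *)
by apply: far; rewrite ?maxE 1?maxnC; apply/ssrnat.leP => //; apply: ltnW.
Qed.

Lemma near_card (i : 'I_N) : \sum_k (near i k)%:R <= (2 * K + 1)%:R :> R.
Proof.
rewrite -natr_sum ler_nat.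
have -> : (\sum_k near i k)%N = size [seq val k | k <- enum (near i)].
  by rewrite size_map -cardE -sum1_card [RHS]big_mkcond.
(* The subtraction is truncated: for [i < K] the window is [0 .. 2K], which still contains every
   index up to [i + K]. *)
rewrite -(size_iota (i - K) (2 * K + 1)); apply: uniq_leq_size.
  by rewrite map_inj_uniq ?enum_uniq //; apply: val_inj.
move=> x /mapP[k]; rewrite mem_enum unfold_in /near /natdist => ik ->.
by rewrite mem_iota /=; lia.
Qed.

(** [xi] does not couple pairs [i <= j] with pairs [i > j], so its form is a sum of two forms of
    [cov]: one at [a], one at the transposed strictly lower part of [a]. *)
Lemma xi_psd (a : 'I_N * 'I_N -> R) :
  0 <= qform (fun p q => xi_ord cov p.1 p.2 q.1 q.2) a.
Proof.
case: adm => _ [psd _].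
pose ext (b : 'I_N * 'I_N -> R) (i j : nat) : R :=
  match insub i : option 'I_N, insub j : option 'I_N with
  | Some i', Some j' => b (i', j') | _, _ => 0 end.
have {}psd b : 0 <= \sum_(i < N) \sum_(j < N) \sum_(k < N) \sum_(l < N)
    (if (i <= j)%N && (k <= l)%N then b (i, j) * b (k, l) * cov i j k l else 0).
  have /RleP := psd (ext b); congr (0 <= _).
  rewrite rsumE; apply: eq_bigr => i _; rewrite rsumE; apply: eq_bigr => j _.
  rewrite rsumE; apply: eq_bigr => k _; rewrite rsumE; apply: eq_bigr => l _.
  by rewrite !lebE /ext !valK.
have H1 := psd a.
(* The inequality is strict so that diagonal pairs are counted in [H1] alone. *)
have H2 := psd (fun p => if (p.1 < p.2)%N then a (p.2, p.1) else 0).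
apply: le_trans (addr_ge0 H1 H2) _; rewrite le_eqVlt; apply/orP; left; apply/eqP.
have -> : qform (fun p q => xi_ord cov p.1 p.2 q.1 q.2) a =
  \sum_(i < N) \sum_(j < N) \sum_(k < N) \sum_(l < N)
    a (i, j) * a (k, l) * xi_ord cov i j k l.
  rewrite /qform [RHS]pair_bigA; apply: eq_bigr => -[i j] _ /=.
  by rewrite [RHS]pair_bigA; apply: eq_bigr => -[k l] _.
rewrite [X in _ + X]exchange_big /= -big_split /=; apply: eq_bigr => i _.
rewrite -big_split /=; apply: eq_bigr => j _.
rewrite [X in _ + X]exchange_big /= -big_split /=; apply: eq_bigr => k _.
rewrite -big_split /=; apply: eq_bigr => l _.
rewrite /xi_ord /xi !lebE !ltbE.
have [ij|ij] := leqP i j; have [kl|kl] := leqP k l => /=.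
- by rewrite mul0r mul0r if_same addr0.
- by rewrite mul0r mul0r if_same mulr0 addr0.
- by rewrite mulr0 mul0r if_same mulr0 addr0.
- by rewrite (ltnW ij) (ltnW kl) add0r.
Qed.

Lemma xi_gram : exists L : seq ('I_N * 'I_N -> R), forall i j k l,
  xi_ord cov i j k l = \sum_(f <- L) f (i, j) * f (k, l).
Proof.
have [|L HL] := psd_gram _ xi_psd; first by move=> p q; apply: xi_sym.
by exists L => i j k l; apply: (HL (i, j) (k, l)).
Qed.

(** Positivity of [Im M] makes the matrix dissipative, hence invertible, so the chosen inverse in
    [Fmap] is a true one. *)
Lemma Fmap_inv z M : 0 < im z -> Mplus N M ->
  dyson (xi_ord (N:=N) cov) (toC z) (mx N M) *m mx N (Fmap N cov z M) = 1%:M.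
Proof.
move=> z0 MP; have [L gram] := xi_gram.
rewrite -mx_dyson; apply: mx_inv; rewrite mx_dyson.
apply: (dissipative_unitmx (eta := im z)) => //.
apply: (dyson_dissipative gram (toC z)) => u; exact: Mplus_imform.
Qed.

End Covariance.

(** The orders are spelled [Rlt] and [Rle] because [<] and [<=] denote the orders of MathComp here;
    this form matches the theorem outside the module. *)
Lemma dyson_stability_supnorm (K : nat) (z : Cplx) : Rlt 0 (im z) ->
  exists eps c : R, Rlt 0 eps /\
    forall (N : nat) (cov : nat -> nat -> nat -> nat -> R),
      cov_admissible K N cov ->
      forall M M' Rm : Mat,
        Mplus N M -> Meq N M (Fmap N cov z M) ->
        Mplus N M' -> Meq N M' (Madd (Fmap N cov z M') Rm) ->
        Rle (Rmax (supnorm N (Msub M' M)) (supnorm N Rm)) eps ->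
        Rle (supnorm N (Msub M' M)) (c * supnorm N Rm).
Proof.
move=> /RltP z0; set eta := im z.
pose w : R := (2 * K + 1)%:R.
have w0 : 0 < w by rewrite /w ltr0n addn1.
(* The largest value with [w ^+ 2 * eps <= eta / 2]; like [w = 2K + 1] and [gam], it depends on [z]
   and [K] alone. *)
pose eps := eta / (2 * w ^+ 2).
pose gam := eta / (2 * (eta + w ^+ 2 * (eta^-1 + eps))).
have eps0 : 0 < eps by rewrite divr_gt0 // mulr_gt0 // exprn_gt0.
have gam0 : 0 < gam.
  rewrite divr_gt0 // mulr_gt0 // addr_gt0 // mulr_gt0 ?exprn_gt0 // addr_gt0 //.
  by rewrite invr_gt0.
have eps_small : w ^+ 2 * eps <= eta / 2.
  rewrite (_ : w ^+ 2 * eps = eta / 2) // /eps; move: w0; clearbody w eta => w0.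
  by field; rewrite gt_eqF.
exists eps, (w ^+ 2 / (eta ^+ 2 * gam) + 1); split; first exact/RltP.
move=> N cov adm M M' Rm MP ME MP' ME' /RleP; rewrite RmaxE ge_max => /andP[_ r_eps].
have [L gram] := xi_gram adm.
have r0 := supnorm_ge0 N Rm.
have ME0 := iffLR (mx_eq _ _ _) ME; have ME0' := iffLR (mx_eq _ _ _) ME'.
apply/RleP; apply: supnorm_le => [|i j].
  rewrite mulr_ge0 // addr_ge0 // divr_ge0 ?sqr_ge0 // mulr_ge0 ?sqr_ge0 //.
  exact: ltW.
rewrite mx_sub.
have stab := dyson_stability (ltW w0) (@near_sym K N) (@near_card K N)
  (xi_diag_le1 adm) (xi_far adm) gram (z0 : 0 < complex.Im (toC z)).
apply: (stab _ _ (mx N (Fmap N cov z M')) (mx N Rm) _ eps) => //.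
- by move=> u; apply: Mplus_imform.
- by move=> u; apply: Mplus_imform.
- by rewrite {2}ME0; apply: (Fmap_inv adm).
- exact: (Fmap_inv adm).
- by rewrite ME0' mx_add.
- exact: normc_mx_le.
Qed.

End DysonStability.

Theorem theorem4p12 (K : nat) (HK : (1 <= K)%nat) (z : Cplx) (Hz : 0 < im z) :
  exists eps c : R, 0 < eps /\
    forall (N : nat) (cov : nat -> nat -> nat -> nat -> R),
      cov_admissible K N cov ->
      forall M M' Rm : Mat,
        Mplus N M -> Meq N M (Fmap N cov z M) ->
        Mplus N M' -> Meq N M' (Madd (Fmap N cov z M') Rm) ->
        Rmax (supnorm N (Msub M' M)) (supnorm N Rm) <= eps ->
        supnorm N (Msub M' M) <= c * supnorm N Rm.
Proof. exact (DysonStability.dyson_stability_supnorm K Hz). Qed.
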